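(* For odd $n$ (with $n\ge3$), the $h^*$-vector of the Laplacian simplex $T_{C_n}$ of the cycle $C_n$ on $n$ vertices is unimodal.
   Context: For a connected graph $G$ on vertex set $[n]$, its Laplacian $L$ has $L_{ii}=\deg(i)$, $L_{ij}=-1$ if $\{i,j\}$ is an edge and $0$ otherwise. Let $A$ be the $n\times(n-1)$ matrix with $a_{ij}=1$ if $i\le j\le n-1$ and $0$ otherwise, and $L_B=LA$. The Laplacian simplex $T_G\subseteq\mathbb{R}^{n-1}$ is the convex hull of the rows of $L_B$. For a $d$-dimensional lattice polytope $P\subseteq\mathbb{R}^m$, the $h^*$-vector $(h_0^*,\dots,h_d^* )$ is defined by $1+\sum_{t\ge1}|tP\cap\mathbb{Z}^m|z^t=\frac{\sum_{i=0}^dh_i^*z^i}{(1-z)^{d+1}}$. A vector $(x_0,\dots,x_d)$ is unimodal if there is $j$ with $x_0\le\cdots\le x_j\ge\cdots\ge x_d$. *)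

(* Defs.v *)
From mathcomp Require Import all_boot all_order all_algebra finmap.
From mathcomp Require Import boolp classical_sets cardinality reals.

Set Implicit Arguments.
Unset Strict Implicit.
Unset Printing Implicit Defensive.

Import Order.TTheory GRing.Theory Num.Theory.

Local Open Scope classical_set_scope.
Local Open Scope ring_scope.

(* A graph on the vertex set 'I_n (vertices shifted from 1..n to 0..n-1) is
   given by its adjacency relation. *)
Definition degree (n : nat) (e : rel 'I_n) (i : 'I_n) : nat :=
  #|[pred j | e i j]|.

Definition laplacian (n : nat) (e : rel 'I_n) : 'M[int]_n :=
  \matrix_(i, j) (if i == j then (degree e i)%:Z else if e i j then -1 else 0).

(* The 0-based condition i <= j for j : 'I_n.-1 is the 1-based i <= j <= n-1. *)
Definition basis_mx (n : nat) : 'M[int]_(n, n.-1) :=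
  \matrix_(i, j) (if (i <= j)%N then 1 else 0).

Definition laplacianB (n : nat) (e : rel 'I_n) : 'M[int]_(n, n.-1) :=
  laplacian e *m basis_mx n.

Definition conv_rows (R : realType) (k m : nat) (V : 'M[R]_(k, m)) :
    set 'rV[R]_m :=
  [set x | exists w : 'rV[R]_k,
     [/\ forall i, 0 <= w 0 i, \sum_i w 0 i = 1 & x = w *m V]].

Definition laplacian_simplex (R : realType) (n : nat) (e : rel 'I_n) :
    set 'rV[R]_(n.-1) :=
  conv_rows (map_mx intr (laplacianB e)).

(* For n >= 3 this is the simple cycle 0 - 1 - ... - (n-1) - 0; ordS is the
   successor modulo n. *)
Definition cycle_graph (n : nat) : rel 'I_n :=
  fun i j => (j == ordS i) || (i == ordS j).

Definition affine_subspace (R : realType) (m : nat)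
    (x : 'rV[R]_m) (U : {vspace 'rV[R]_m}) : set 'rV[R]_m :=
  [set y | y - x \in U].

Definition has_dim (R : realType) (m : nat) (P : set 'rV[R]_m) (d : nat) :
    Prop :=
  (exists x U, P `<=` affine_subspace x U /\ \dim U = d) /\
  (forall x U, P `<=` affine_subspace x U -> (d <= \dim U)%N).

Definition dilate (R : realType) (m t : nat) (P : set 'rV[R]_m) :
    set 'rV[R]_m :=
  [set t%:R *: x | x in P].

Definition int_lattice (R : realType) (m : nat) : set 'rV[R]_m :=
  [set x | forall i, x 0 i \is a Num.int].

(* fset_set sends infinite sets to fset0; see finite_lattice_points below for
   the finiteness of these sets when P is a polytope. *)
Definition lattice_count (R : realType) (m : nat) (P : set 'rV[R]_m) (t : nat) :
    nat :=
  #|` fset_set (dilate t P `&` @int_lattice R m) |%fset.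

(* Formal power series in z are given by their coefficient sequences. *)
Definition ehrhart_series (R : realType) (m : nat) (P : set 'rV[R]_m) :
    nat -> int :=
  fun t => if t == 0%N then 1 else (lattice_count P t)%:Z.

Definition series_mul (f g : nat -> int) : nat -> int :=
  fun k => \sum_(i < k.+1) f i * g (k - i)%N.

(* h = (h_0, ..., h_d), where
   (1 - z)^(d+1) * (1 + \sum_(t >= 1) |tP /\ Z^m| z^t) = \sum_(i <= d) h_i z^i
   coefficient by coefficient (h`_k = 0 for k > d). *)
Definition hstar_vector (R : realType) (m : nat) (P : set 'rV[R]_m)
    (h : seq int) : Prop :=
  exists d : nat,
    [/\ has_dim P d, size h = d.+1 &
        forall k : nat,
          series_mul (fun i => ((1 - 'X) ^+ d.+1 : {poly int})`_i)
                     (ehrhart_series P) k = h`_k].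

Definition unimodal (h : seq int) : Prop :=
  exists j : nat,
    [/\ (j < size h)%N,
        forall i : nat, (i < j)%N -> h`_i <= h`_i.+1 &
        forall i : nat, (j <= i)%N -> (i.+1 < size h)%N -> h`_i.+1 <= h`_i].

Lemma has_dim_uniq (R : realType) (m : nat) (P : set 'rV[R]_m) (d d' : nat) :
  has_dim P d -> has_dim P d' -> d = d'.
Proof.
move=> [[x [U [PU dU]]] dmin] [[x' [U' [PU' dU']]] dmin'].
by apply/eqP; rewrite eqn_leq -{1}dU' -{2}dU (dmin _ _ PU') (dmin' _ _ PU).
Qed.

Lemma hstar_vector_uniq (R : realType) (m : nat) (P : set 'rV[R]_m)
    (h h' : seq int) :
  hstar_vector P h -> hstar_vector P h' -> h = h'.
Proof.
move=> [d [Pd sh hE]] [d' [Pd' sh' hE']].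
have dd' := has_dim_uniq Pd Pd'; rewrite -{d' Pd'}dd' in sh' hE'.
apply: (@eq_from_nth _ 0); first by rewrite sh sh'.
by move=> i _; rewrite -hE -hE'.
Qed.

Lemma finite_lattice_points (R : realType) (k m t : nat) (V : 'M[R]_(k, m)) :
  finite_set (dilate t (conv_rows V) `&` @int_lattice R m).
Proof.
pose M : R := t%:R * \sum_i \sum_j `|V i j|.
have [N MN] : exists N : nat, M <= N%:R.
  exists (Num.bound M); apply: ltW; apply: archi_boundP.
  by rewrite mulr_ge0 ?ler0n// sumr_ge0// => i _; rewrite sumr_ge0.
pose f (v : 'rV['I_(N + N).+1]_m) : 'rV[R]_m :=
  \row_j ((v 0 j : nat)%:R - N%:R).
apply: (@sub_finite_set _ _ (range f)); last exact/finite_image/finite_finset.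
move=> x [[y [w [w0 w1 ->]] <-] xint].
have w_le1 i : w 0 i <= 1.
  by rewrite -w1 (bigD1 i)//= lerDl sumr_ge0// => j _; exact: w0.
have bnd j : `|(t%:R *: (w *m V)) 0 j| <= N%:R.
  apply: le_trans MN; rewrite !mxE normrM ger0_norm ?ler0n// ler_wpM2l ?ler0n//.
  apply: le_trans (ler_norm_sum _ _ _) _; apply: ler_sum => i _.
  rewrite normrM ger0_norm//; apply: (@le_trans _ _ `|V i j|).
    by rewrite ler_piMl.
  by rewrite (bigD1 j)//= lerDl sumr_ge0.
move: (t%:R *: (w *m V)) xint bnd => X xint bnd.
exists (\row_j inord (Num.truncn (X 0 j + N%:R))) => //.
apply/rowP => j; rewrite !mxE.
have [p pE] : exists p : nat, X 0 j = p%:R - N%:R.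
  have : X 0 j + N%:R \is a Num.nat.
    rewrite natrEint rpredD ?natr_int//=.
    by have := bnd j; rewrite ler_norml -lerBlDr sub0r => /andP[].
  by move=> /natrP[p pE]; exists p; rewrite -pE addrK.
rewrite pE subrK natrK inordK// ltnS -(ler_nat R) natrD -lerBlDr -pE.
exact: le_trans (ler_norm _) (bnd j).
Qed.

Lemma cycle_graph_sym (n : nat) : symmetric (@cycle_graph n).
Proof. by move=> i j; rewrite /cycle_graph orbC. Qed.

Lemma cycle_graph_irr (n : nat) : (1 < n)%N -> irreflexive (@cycle_graph n).
Proof.
move=> n1 i; rewrite /cycle_graph orbb; apply/negP => /eqP/(congr1 val)/=.
have := ltn_ord i; rewrite leq_eqVlt => /predU1P[ni|lt_i]; last first.
  by rewrite modn_small// => /n_Sn.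
by rewrite ni modnn => i0; move: n1; rewrite -ni i0.
Qed.

Lemma cycle_graph_connected (n : nat) (i j : 'I_n) :
  connect (@cycle_graph n) i j.
Proof.
case: n i j => [[]//|n] i j.
suff c0 (k : 'I_n.+1) : connect (@cycle_graph n.+1) ord0 k.
  apply: connect_trans (c0 j); rewrite (sym_connect_sym (@cycle_graph_sym n.+1)); exact: c0.
case: k => k; elim: k => [|k IHk] lt_k.
  by rewrite (_ : Ordinal _ = ord0) ?connect0//; exact: val_inj.
apply: connect_trans (IHk (ltnW lt_k)) _; apply: connect1.
by apply/orP; left; apply/eqP/val_inj; rewrite /= modn_small.
Qed.

(* Main.v *)
(** In barycentric coordinates the column sums of the Laplacian telescope, so a
    point with coordinates [w] is integral iff the cyclic differences of [w] are
    all congruent mod Z.  For odd [n] this means that the lattice points of the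
    [t]-th dilate are the [w_i = u_i + ((m + i k) mod n) / n] with [m, k < n],
    [u_i] natural and [sum w = t].  If [g = gcd(k, n)], the fractional parts sum
    to [m mod g + (n - g) / 2], and [h*_j] counts the pairs [(m, k)] for which
    this height is [j].  For a fixed [k] the heights are equidistributed on an
    interval of length [g] centred at [(n - 1) / 2]; hence [h*] is a sum of
    unimodal vectors with the common centre [(n - 1) / 2]. *)

Require Import Defs.
From mathcomp Require Import all_boot all_order all_algebra finmap.
From mathcomp Require Import zify ring.
From mathcomp Require Import boolp classical_sets cardinality reals.

Set Implicit Arguments.
Unset Strict Implicit.
Unset Printing Implicit Defensive.

Import Order.TTheory GRing.Theory Num.Theory.

Local Open Scope classical_set_scope.
Local Open Scope ring_scope.

(** * Residues of arithmetic progressions *)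

(** Since [c] is a unit modulo [q], the progression permutes the residues, and the sum is
    [0 + ... + (q - 1)]. *)
Lemma sum_progression_mod_coprime (q a c : nat) : coprime c q ->
  (\sum_(i < q) (a + i * c) %% q = 'C(q, 2))%N.
Proof.
case: q => [|q] co; first by rewrite big_ord0.
pose f (i : 'I_q.+1) : 'I_q.+1 := inord ((a + i * c) %% q.+1).
have fE i : f i = ((a + i * c) %% q.+1)%N :> nat by rewrite inordK// ltn_pmod.
have finj : injective f.
  move=> i j /(congr1 val) /=; rewrite !fE => /eqP; rewrite eqn_modDl => eqij.
  apply/val_inj => /=; wlog lt_ij : i j eqij / (i < j)%N => [hw|].
    have [/hw|/hw|//] := ltngtP i j; first exact.
    by move=> h; apply/esym/h; rewrite eq_sym.
  move: eqij; rewrite eq_sym eqn_mod_dvd ?leq_mul2r ?(ltnW lt_ij) ?orbT//.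
  rewrite -mulnBl Gauss_dvdl 1?coprime_sym// => /dvdn_leq.
  by rewrite subn_gt0 lt_ij => /(_ isT); have := ltn_ord j; lia.
rewrite -bin2_sum big_mkord [RHS](reindex_inj finj).
by apply: eq_bigr => i _; rewrite fE.
Qed.

Lemma sum_periodic (F : nat -> nat) (q g : nat) :
  (forall i, F (q + i)%N = F i) ->
  (\sum_(i < g * q) F i = g * \sum_(i < q) F i)%N.
Proof.
move=> Fq; elim: g => [|g IHg]; first by rewrite !mul0n big_ord0.
rewrite mulSn big_split_ord/= mulSn -IHg; congr (_ + _)%N.
by apply: eq_bigr => i _; rewrite Fq.
Qed.

Lemma modn_mull_add (g q m x : nat) : (0 < g)%N -> (0 < q)%N ->
  ((m + g * x) %% (g * q) = m %% g + g * ((m %/ g + x) %% q))%N.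
Proof.
move=> g0 q0; rewrite {1}(divn_eq m g) addnAC [(_ %/ _ * _)%N]mulnC -mulnDr.
rewrite {1}(divn_eq (m %/ g + x) q) mulnDr mulnCA -addnA modnMDl modn_small.
  by rewrite addnC.
have := ltn_pmod m g0; have : ((m %/ g + x) %% q < q)%N by rewrite ltn_pmod.
move: (m %% g)%N (_ %% q)%N => r s; nia.
Qed.

(** For odd [n] the difference [n - gcdn k n] is even, so the halving is exact. *)
Definition height (n m k : nat) : nat :=
  m %% gcdn k n + (n - gcdn k n)./2.

(** Put [g = gcdn k n], [k = g * c], [n = g * q]. Each term is [m %% g] plus [g] times a residue
    modulo [q], and these residues run [g] times through a full system because [c] is coprime to
    [q]. *)
Lemma sum_progression_mod (n m k : nat) : odd n ->
  (\sum_(i < n) (m + i * k) %% n = n * height n m k)%N.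
Proof.
move=> n_odd; rewrite /height; set g := gcdn k n.
have n0 : (0 < n)%N by case: n n_odd @g.
have g0 : (0 < g)%N by rewrite gcdn_gt0 n0 orbT.
have [c kE] : exists c, k = (g * c)%N.
  by exists (k %/ g)%N; rewrite mulnC divnK// dvdn_gcdl.
have [q nE] : exists q, n = (g * q)%N.
  by exists (n %/ g)%N; rewrite mulnC divnK// dvdn_gcdr.
have q0 : (0 < q)%N by move: n0; rewrite nE; case: (q); rewrite ?muln0.
have co : coprime c q.
  by rewrite /coprime -(eqn_pmul2l g0) muln_gcdr -kE -nE muln1.
have q_odd : odd q by move: n_odd; rewrite nE oddM => /andP[].
clearbody g; rewrite {}kE {k} in co *; rewrite {}nE {n} in n_odd n0 *.
under eq_bigr => i _ do rewrite mulnCA modn_mull_add//.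
rewrite big_split/= sum_nat_const card_ord -big_distrr/=.
rewrite (@sum_periodic (fun i => (m %/ g + i * c) %% q)%N); last first.
  by move=> i; rewrite mulnDl [(q * c)%N]mulnC addnCA modnMDl.
rewrite sum_progression_mod_coprime// bin2odd// mulnDr; congr (_ + _)%N.
have -> : (g * q - g = (g * q.-1./2).*2)%N.
  rewrite doubleMr -[X in (_ * q - X)%N]muln1 -mulnBr subn1; congr muln.
  by rewrite -(odd_double_half q) q_odd /= add0n doubleK.
by rewrite doubleK; ring.
Qed.

Lemma height_lt (n m k : nat) : (0 < n)%N -> (height n m k < n)%N.
Proof.
move=> n0; have g0 : (0 < gcdn k n)%N by rewrite gcdn_gt0 n0 orbT.
have := dvdn_leq n0 (dvdn_gcdr k n); have := ltn_pmod m g0; rewrite /height.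
by lia.
Qed.

(** * The height polynomial and the monotonicity of its coefficients *)

(** For odd [n >= 3] this is the h*-polynomial of the cycle simplex. *)
Definition height_poly (n : nat) : {poly int} :=
  \sum_(mk : 'I_n * 'I_n) 'X^(height n mk.1 mk.2).

Lemma coef_height_poly (n j : nat) :
  (height_poly n)`_j = (\sum_(k < n) #|[pred m : 'I_n | height n m k == j]|)%:Z.
Proof.
have -> : (\sum_(k < n) #|[pred m : 'I_n | height n m k == j]| =
    \sum_(mk : 'I_n * 'I_n) (height n mk.1 mk.2 == j))%N.
  rewrite -(pair_bigA _ (fun m k : 'I_n => nat_of_bool (height n m k == j)))/=.
  rewrite exchange_big/=; apply: eq_bigr => k _.
  by rewrite -sum1_card big_mkcond.
rewrite coef_sum -natz natr_sum; apply: eq_bigr => mk _.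
by rewrite coefXn eq_sym.
Qed.

Lemma coef_height_poly_ge (n j : nat) : (n <= j)%N -> (height_poly n)`_j = 0.
Proof.
move=> nj; rewrite coef_sum big1// => -[m k] _; rewrite coefXn/=.
case: eqP => // jE; have := @height_lt n m k (leq_ltn_trans (leq0n m) (ltn_ord m)).
by rewrite -jE ltnNge nj.
Qed.

(** For each [k], the shift [m -> m + 1] injects height [j] into height [j + 1]: below the centre
    [m %% g < (g - 1) / 2], so the residue modulo [g] does not wrap around. *)
Lemma coef_height_poly_incr (n j : nat) : odd n -> (j < n./2)%N ->
  (height_poly n)`_j <= (height_poly n)`_j.+1.
Proof.
move=> n_odd jn; rewrite !coef_height_poly lez_nat; apply: leq_sum => k _.
have n0 : (0 < n)%N by lia.
rewrite /height; set g := gcdn k n.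
have g0 : (0 < g)%N by rewrite gcdn_gt0 n0 orbT.
have gn : (g %| n)%N by rewrite dvdn_gcdr.
have g_odd : odd g := dvdn_odd gn n_odd.
have mS m : (m %% g + (n - g)./2 = j -> m.+1 %% g = (m %% g).+1)%N.
  move=> mE; rewrite -addn1 -modnDml addn1 modn_small//.
  have := dvdn_leq n0 gn; lia.
(* If [m + 1 = n], its residue modulo [g] would be 0 and not a successor. Hence [insubd] below never
   returns its default on the elements counted. *)
have mlt (m : 'I_n) : (m %% g + (n - g)./2 = j -> m.+1 < n)%N.
  move=> /mS mE; rewrite ltn_neqAle ltn_ord andbT; apply: contra_eq_neq mE => /= ->.
  by rewrite (eqP gn).
rewrite -[X in (X <= _)%N](@card_in_image _ _ (fun m : 'I_n => insubd m m.+1)).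
  apply/subset_leq_card/fintype.subsetP => _ /fintype.imageP[m /eqP mj ->].
  by rewrite !inE val_insubd (mlt _ mj) mS// -mj addSn.
move=> m1 m2 /eqP m1j /eqP m2j /(congr1 val)/=.
by rewrite !val_insubd !mlt// => -[] /val_inj.
Qed.

(** Mirror image of the increasing case: above the centre [m %% g] is positive, so [m -> m - 1]
    lowers the height by one. *)
Lemma coef_height_poly_decr (n j : nat) : odd n -> (n./2 <= j)%N ->
  (height_poly n)`_j.+1 <= (height_poly n)`_j.
Proof.
move=> n_odd jn; rewrite !coef_height_poly lez_nat; apply: leq_sum => k _.
have n0 : (0 < n)%N by lia.
rewrite /height; set g := gcdn k n.
have g0 : (0 < g)%N by rewrite gcdn_gt0 n0 orbT.
have gn : (g %| n)%N by rewrite dvdn_gcdr.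
have g_odd : odd g := dvdn_odd gn n_odd.
have mP m : (m %% g + (n - g)./2 = j.+1 -> (m.-1 %% g).+1 = m %% g /\ 0 < m)%N.
  move=> mE; have mg : (0 < m %% g)%N by have := dvdn_leq n0 gn; lia.
  case: m mE mg => [|m] mE mg /=; first by rewrite mod0n in mg.
  by split => //; move: mg; rewrite modnS; case: ifP.
have lem (m : 'I_n) : (m.-1 < n)%N by have := ltn_ord m; lia.
rewrite -[X in (X <= _)%N]
  (@card_in_image _ _ (fun m : 'I_n => Ordinal (lem m))).
  apply/subset_leq_card/fintype.subsetP => _ /fintype.imageP[m /eqP mj ->].
  by have [mE _] := mP _ mj; rewrite !inE/= -eqSS -addSn mE; apply/eqP.
(* Positivity gives injectivity, since the truncated predecessor identifies 0 and 1. *)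
move=> m1 m2 /eqP /mP[_ m10] /eqP /mP[_ m20] /(congr1 val)/= E.
by apply/val_inj => /=; rewrite -(prednK m10) E prednK.
Qed.

(** * Truncated geometric series in place of [1 / (1 - z)] *)

(** The product of [1 - 'X] with the truncated sum is [1 - 'X^(T.+1)], whose powers are 1 modulo
    ['X^(T.+1)]. Polynomials can thus replace power series up to degree [T]. *)
Lemma coef_exp_geometric (n T : nat) (p : {poly int}) (k : nat) : (k <= T)%N ->
  ((1 - 'X) ^+ n * (p * (\sum_(i < T.+1) 'X^i) ^+ n))`_k = p`_k.
Proof.
have geo : (1 - 'X) * (\sum_(i < T.+1) 'X^i) = 1 - 'X^(T.+1) :> {poly int}.
  by rewrite -[1 - 'X]opprB mulNr -subrX1 opprB.
have [q qE] : exists q : {poly int}, (1 - 'X^(T.+1)) ^+ n = 1 + 'X^(T.+1) * q.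
  exists (- \sum_(i < n) (1 - 'X^(T.+1)) ^+ i).
  apply: (addIr (-1)); rewrite [RHS]addrAC subrr add0r subrX1 mulrN -mulNr.
  by rewrite addrAC subrr add0r.
move=> kT; rewrite mulrCA -exprMn geo qE mulrDr mulr1 coefD mulrCA coefXnM.
by rewrite ltnS kT addr0.
Qed.

(** Expanding the power picks one exponent per factor; this choice is the function [u] of integral
    parts. *)
Lemma coef_height_poly_geometric (n T t : nat) :
  (height_poly n * (\sum_(i < T.+1) 'X^i) ^+ n)`_t =
  #|[pred a : 'I_n * 'I_n * {ffun 'I_n -> 'I_T.+1} |
      \sum_i a.2 i + height n a.1.1 a.1.2 == t]%N|%:Z.
Proof.
have -> : (\sum_(i < T.+1) 'X^i) ^+ n =
    \sum_(u : {ffun 'I_n -> 'I_T.+1}) 'X^(\sum_i u i) :> {poly int}.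
  rewrite -[n in LHS]card_ord -prodr_const bigA_distr_bigA/=.
  by apply: eq_bigr => u _; rewrite -expr_sum.
rewrite /height_poly big_distrlr/= pair_bigA coef_sum -sum1_card -natz natr_sum.
rewrite [RHS]big_mkcond/=; apply: eq_bigr => -[mk u] _ /=.
by rewrite -exprD coefXn eq_sym addnC inE/=; case: eqP.
Qed.

(** * The Laplacian of the cycle in barycentric coordinates *)

Lemma val_ordS (p : nat) (i : 'I_p.+1) :
  ordS i = (if i == p :> nat then 0 else i.+1)%N :> nat.
Proof.
case: eqP => [|/eqP] ip /=; first by rewrite ip modnn.
by rewrite modn_small// ltnS ltn_neqAle ip -ltnS ltn_ord.
Qed.

Lemma val_ord_pred (p : nat) (i : 'I_p.+1) :
  ord_pred i = (if i == 0 :> nat then p else i.-1)%N :> nat.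
Proof.
case: i => -[|i] lt_i /=; first by rewrite modn_small.
by rewrite modnDr modn_small// ltnW.
Qed.

Lemma eq_ordS (p : nat) (i j : 'I_p.+1) : (i == ordS j) = (j == ord_pred i).
Proof. by apply/eqP/eqP => ->; rewrite ?ordSK ?ord_predK. Qed.

Lemma cycle_degree (p : nat) (i : 'I_p.+1) : (1 < p)%N ->
  degree (@cycle_graph p.+1) i = 2%N.
Proof.
move=> p1; rewrite /degree -(@eq_card _ (pred2 (ordS i) (ord_pred i))).
  rewrite card2 -(inj_eq val_inj) [val _]val_ordS [X in _ != X]val_ord_pred.
  rewrite (_ : _ != _)//; have := ltn_ord i; move: (nat_of_ord i) => x.
  by case: (x =P p) => ?; case: (x =P 0%N) => ?; lia.
by move=> j; rewrite !inE /cycle_graph [i == ordS j]eq_ordS.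
Qed.

Lemma cycle_laplacianE (p : nat) (i j : 'I_p.+1) : (1 < p)%N ->
  laplacian (@cycle_graph p.+1) i j =
  (i == j)%:R *+ 2 - (i == ord_pred j)%:R - (i == ordS j)%:R.
Proof.
move=> p1; rewrite mxE cycle_degree// /cycle_graph [j == ordS i]eq_ordS.
have [<-|ij] := eqVneq i j.
  have := @cycle_graph_irr p.+1 (ltnW p1) i.
  by rewrite /cycle_graph [i == ordS i]eq_ordS orbb => ->; rewrite !subr0.
rewrite mul0rn sub0r.
have [ip|_] := eqVneq i (ord_pred j); have [iS|_] := eqVneq i (ordS j) => //=.
(* The two neighbours of a vertex coincide only on a cycle with at most two vertices. *)
exfalso; move: ip; rewrite {}iS => /(congr1 (@nat_of_ord _)).
rewrite val_ordS val_ord_pred; have := ltn_ord j; move: (nat_of_ord j) => x.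
by case: (x =P p) => ?; case: (x =P 0%N) => ?; lia.
Qed.

Lemma mul_cycle_laplacianE (R : realType) (p : nat) (w : 'rV[R]_p.+1) j :
  (1 < p)%N -> (w *m map_mx intr (laplacian (@cycle_graph p.+1))) 0 j =
    w 0 j *+ 2 - w 0 (ord_pred j) - w 0 (ordS j).
Proof.
move=> p1; rewrite mxE.
have sumd k : \sum_i w 0 i * (i == k)%:R = w 0 k.
  rewrite (bigD1 k)//= eqxx mulr1 big1 ?addr0// => i /negPf ->.
  by rewrite mulr0.
rewrite -3!sumd -sumrMnl -!sumrB; apply: eq_bigr => i _.
rewrite mxE cycle_laplacianE// 2!rmorphB rmorphMn/= !mulrz_nat.
by rewrite !mulrBr mulrnAr.
Qed.

(* Telescoping: column [j] sums the columns [0..j] of the Laplacian. *)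
Lemma mul_cycle_laplacianBE (R : realType) (p : nat) (w : 'rV[R]_p.+1)
    (j : 'I_p) : (1 < p)%N ->
  (w *m map_mx intr (laplacianB (@cycle_graph p.+1))) 0 j =
    w 0 ord0 - w 0 ord_max - (w 0 (lift ord0 j) - w 0 (widen_ord (leqnSn p) j)).
Proof.
move=> p1; rewrite /laplacianB map_mxM mulmxA mxE.
have -> : lift ord0 j = inord j.+1 :> 'I_p.+1.
  by apply/val_inj; rewrite /= inordK// ltnS.
have -> : widen_ord (leqnSn p) j = inord j.
  by apply/val_inj; rewrite /= inordK// ltnS ltnW.
under eq_bigr => k _ do rewrite mul_cycle_laplacianE// !mxE.
case: j => j /= jp.
transitivity (\sum_(k < p.+1 | (k <= j)%N)
   (w 0 k *+ 2 - w 0 (ord_pred k) - w 0 (ordS k))).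
  rewrite [RHS]big_mkcond/=; apply: eq_bigr => k _.
  by case: ifP => _; rewrite /= ?mulr1 ?mulr0.
have ordSE i : (i < p)%N -> ordS (inord i) = inord i.+1 :> 'I_p.+1.
  move=> ip; apply/val_inj; rewrite [LHS]val_ordS inordK ?ltnS 1?ltnW//.
  by rewrite ltn_eqF//= inordK.
elim: j jp => [|j IHj] jp.
  rewrite (big_pred1 ord0); last by move=> k; rewrite leqn0.
  have -> : ord_pred ord0 = ord_max :> 'I_p.+1.
    by apply/val_inj; rewrite [LHS]val_ord_pred.
  have i0 : inord 0 = ord0 :> 'I_p.+1 by apply/val_inj; rewrite /= inordK.
  by rewrite -[X in ordS X]i0 ordSE// i0; ring.
have jlt : (j.+1 < p.+1)%N by rewrite ltnW.
rewrite (bigD1 (inord j.+1))/= ?inordK//.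
rewrite (eq_bigl (fun k : 'I_p.+1 => k <= j)%N); last first.
  by move=> k; rewrite -(inj_eq val_inj)/= inordK//; lia.
rewrite IHj ?(ltnW jp)// ordSE//.
have -> : ord_pred (inord j.+1) = inord j :> 'I_p.+1.
  by apply/val_inj; rewrite [LHS]val_ord_pred inordK//= inordK// ltnW.
by ring.
Qed.

(** By telescoping, each consecutive difference of [w] is congruent to [d] modulo [S], and these
    congruences add up. The set [S] is abstract in order to cover both the integers (lattice points)
    and [{0}] (injectivity). *)
Lemma cycle_coord_progression (R : realType) (p : nat) (S : {pred R})
    (w : 'rV[R]_p.+1) : (1 < p)%N -> zmod_closed S ->
  (forall j, (w *m map_mx intr (laplacianB (@cycle_graph p.+1))) 0 j \in S) ->
  let d := w 0 ord0 - w 0 ord_max in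
  (forall i : 'I_p.+1, w 0 i - w 0 ord0 - d *+ i \in S) /\ d *+ p.+1 \in S.
Proof.
move=> p1 [S0 SB] wS d.
have SN x : x \in S -> - x \in S by move=> xS; rewrite -sub0r SB.
have prog (i : 'I_p.+1) : w 0 i - w 0 ord0 - d *+ i \in S.
  case: i => i; elim: i => [|i IHi] lt_i.
    by rewrite (_ : Ordinal _ = ord0) ?subrr ?subr0//; exact: val_inj.
  have := SB _ _ (IHi (ltnW lt_i)) (wS (Ordinal (lt_i : (i < p)%N))).
  rewrite mul_cycle_laplacianBE// -/d.
  have -> : lift ord0 (Ordinal (lt_i : (i < p)%N)) = Ordinal lt_i by exact: val_inj.
  have -> : widen_ord (leqnSn p) (Ordinal (lt_i : (i < p)%N)) = Ordinal (ltnW lt_i).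
    exact: val_inj.
  by congr (_ \in S); rewrite /= mulrS; ring.
(* At the last index, [w 0 ord_max - w 0 ord0] is [- d], which closes the cycle. *)
split => //; rewrite -[d *+ _]opprK; apply: SN.
by have := prog ord_max; congr (_ \in S); rewrite /= mulrS /d; ring.
Qed.

(** Affine independence of the vertices: with [S = {0}] the common difference vanishes, so [w] is
    constant, and its sum is zero. *)
Lemma mul_cycle_laplacianB_inj (R : realType) (p : nat) (w : 'rV[R]_p.+1) :
  (1 < p)%N -> w *m map_mx intr (laplacianB (@cycle_graph p.+1)) = 0 ->
  \sum_i w 0 i = 0 -> w = 0.
Proof.
move=> p1 wV0 w0.
have [||wE dE] := @cycle_coord_progression R p (pred1 0) w p1.
- by split=> [|x y]; rewrite !inE// => /eqP-> /eqP->; rewrite subrr.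
- by move=> j; rewrite wV0 mxE inE.
move: dE wE; rewrite inE mulrn_eq0/= => /eqP-> wE.
have {}wE i : w 0 i = w 0 ord0.
  by have := wE i; rewrite inE mul0rn subr0 subr_eq0 => /eqP.
apply/rowP => i; rewrite mxE wE; apply/eqP; move: w0.
rewrite (eq_bigr _ (fun i _ => wE i)) sumr_const card_ord => /eqP.
by rewrite mulrn_eq0.
Qed.

(** * Dimension of the simplex *)

Lemma conv_rows_row (R : realType) (k m : nat) (V : 'M[R]_(k, m)) i :
  conv_rows V (row i V).
Proof.
exists (delta_mx 0 i); split=> [j||]; last exact: rowE.
  by rewrite mxE ler0n.
rewrite (bigD1 i)//= mxE !eqxx big1 ?addr0// => j /negPf ji.
by rewrite mxE ji andbF.
Qed.

Lemma cycle_simplex_dim (R : realType) (p : nat) : (1 < p)%N ->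
  has_dim (@laplacian_simplex R p.+1 (@cycle_graph p.+1)) p.
Proof.
move=> p1; have dimE : \dim {: 'rV[R]_p} = p by rewrite dimvf dim_matrix mul1r.
split; first by exists 0, fullv; split => // x _; rewrite /affine_subspace/= memvf.
move=> x U; rewrite /laplacian_simplex /=; set V := map_mx _ _ => PU.
have VU i : row i V - x \in U.
  exact/PU/conv_rows_row.
rewrite -{1}dimE; apply: dimvS; apply/subvP => y _.
(* The extra column of ones records the sum of the weights. As [M] is invertible, any [y] is a
   combination of the rows of [V] with weights of sum 0, hence a combination of the differences
   [row i V - x]. *)
pose M : 'M[R]_(p.+1, p + 1) := row_mx V (const_mx 1).
have freeM : row_free M.
  apply: inj_row_free => w; rewrite mul_mx_row -[0]hsubmxK linear0 linear0.
  move=> /eq_row_mx[wV w1]; apply: (mul_cycle_laplacianB_inj p1 wV).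
  move: w1 => /matrixP/(_ 0 0); rewrite !mxE => w1.
  by rewrite -[RHS]w1; apply: eq_bigr => i _; rewrite mxE mulr1.
have fullM : row_full M by rewrite /row_full (eqP freeM) addn1.
have /submxP[w] := submx_full (row_mx y (0 : 'M_1)) fullM.
rewrite mul_mx_row => /eq_row_mx[-> /matrixP/(_ 0 0)]; rewrite !mxE => w0.
have -> : w *m V = \sum_i w 0 i *: (row i V - x).
  under eq_bigr do rewrite scalerBr.
  rewrite sumrB -mulmx_sum_row -scaler_suml (_ : \sum_i _ = 0) ?scale0r ?subr0//.
  by rewrite [RHS]w0; apply: eq_bigr => i _; rewrite mxE mulr1.
by apply: rpred_sum => i _; apply: rpredZ.
Qed.

(** * Lattice points of the dilates *)

Lemma dilate_conv_rowsP (R : realType) (k m t : nat) (V : 'M[R]_(k.+1, m)) x :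
  dilate t (conv_rows V) x <->
  exists w : 'rV[R]_k.+1,
    [/\ forall i, 0 <= w 0 i, \sum_i w 0 i = t%:R & x = w *m V].
Proof.
split=> [[_ [w [w0 w1 ->]] <-]|[w [w0 wt ->]]].
  exists (t%:R *: w); split=> [i||]; last by rewrite scalemxAl.
    by rewrite mxE mulr_ge0.
  by under eq_bigr do rewrite mxE; rewrite -mulr_sumr w1 mulr1.
have [t0|t0] := posnP t; last first.
  exists (t%:R^-1 *: (w *m V)); last first.
    by rewrite scalerA divff ?scale1r// pnatr_eq0 -lt0n.
  exists (t%:R^-1 *: w); split=> [i||]; last by rewrite scalemxAl.
    by rewrite mxE mulr_ge0 ?invr_ge0.
  under eq_bigr do rewrite mxE.
  by rewrite -mulr_sumr wt mulVf// pnatr_eq0 -lt0n.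
(* For [t = 0] rescaling is impossible: the weights vanish, and any vertex serves as the point to
   dilate. *)
have -> : w = 0.
  apply/rowP => i; rewrite mxE; apply/eqP; move/eqP: wt; rewrite t0 psumr_eq0//.
  by move=> /allP/(_ i); rewrite mem_index_enum => /(_ isT).
rewrite mul0mx t0; exists (row ord0 V); last by rewrite scale0r.
exact: conv_rows_row.
Qed.

(* Barycentric coordinates of the lattice point attached to [(m, k, u)]: the
   classes of the sequences [(m + i k) / n], with [m, k < n], form the finite
   group of the simplex, and [u] is the integral part. *)
Definition cycle_point (R : realType) (n T : nat)
    (a : 'I_n * 'I_n * {ffun 'I_n -> 'I_T.+1}) : 'rV[R]_n :=
  \row_i ((a.2 i)%:R + ((a.1.1 + i * a.1.2) %% n)%:R / n%:R).

Lemma cycle_point_ge0 (R : realType) (n T : nat) a i :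
  0 <= @cycle_point R n T a 0 i.
Proof. by rewrite mxE addr_ge0// divr_ge0. Qed.

Lemma sum_cycle_point (R : realType) (n T : nat) a : odd n ->
  \sum_i @cycle_point R n T a 0 i =
  (\sum_i a.2 i + height n a.1.1 a.1.2)%N%:R.
Proof.
move=> n_odd; under [LHS]eq_bigr => i _ do rewrite mxE.
rewrite big_split/= -mulr_suml -!natr_sum sum_progression_mod// natrD natrM.
by rewrite mulrAC divff ?mul1r// pnatr_eq0; case: n n_odd a.
Qed.

(** Modulo the integers the coordinates are [(m + i * k) / n], so the wrap-around difference and a
    consecutive one contribute [- (p + 1) * k / n = - k]. *)
Lemma cycle_point_int (R : realType) (p T : nat) a j : (1 < p)%N ->
  (@cycle_point R p.+1 T a *m
     map_mx intr (laplacianB (@cycle_graph p.+1))) 0 j \is a Num.int.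
Proof.
move=> p1; case: a => [[m k] u]; rewrite mul_cycle_laplacianBE//.
have [f fE] : exists f : 'I_p.+1 -> int, forall i,
    cycle_point R (m, k, u) 0 i = (f i)%:~R + (m + i * k)%:R / p.+1%:R.
  exists (fun i => (u i)%:Z - ((m + i * k) %/ p.+1)%:Z) => i.
  rewrite mxE/= {3}(divn_eq (m + i * k) p.+1) rmorphB/= -!pmulrn natrD natrM.
  by rewrite mulrDl mulfK ?pnatr_eq0//; ring.
rewrite !fE /= !natrD !natrM /bump/=.
set X := (X in X \is a _).
have -> : X = (f ord0 - f ord_max -
    (f (lift ord0 j) - f (widen_ord (leqnSn p) j)) - k%:Z)%:~R.
  rewrite /X !rmorphB/= -!pmulrn -natr1.
  by field; rewrite natr1 pnatr_eq0.
exact: intr_int.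
Qed.

(** After multiplication by [n], Euclidean division separates [u] from the residues; indices 0 and 1
    then recover [m] and [k]. *)
Lemma cycle_point_inj (R : realType) (n T : nat) : (1 < n)%N ->
  injective (@cycle_point R n T).
Proof.
move=> n1 [[m k] u] [[m' k'] u'] /rowP E.
have n0 : (0 < n)%N by exact: ltnW.
have {E}/all_and2[uE rE] (i : 'I_n) :
    u i = u' i :> nat /\ (m + i * k = m' + i * k' %[mod n])%N.
  have := E i; rewrite !mxE/= => /(congr1 (fun x => x * n%:R)).
  rewrite !mulrDl !divfK ?pnatr_eq0 -?lt0n// -!natrM -!natrD => /eqP.
  rewrite eqr_nat => /eqP E'; split.
    have := congr1 (divn^~ n) E'.
    by rewrite !divnMDl// !divn_small ?ltn_mod// !addn0.
  by have := congr1 (modn^~ n) E'; rewrite !modnMDl !modn_mod.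
have mE : m = m'.
  apply/val_inj; have := rE (Ordinal n0).
  by rewrite /= !mul0n !addn0 !modn_small.
congr (_, _, _) => //; last by apply/ffunP => i; apply/val_inj/uE.
apply/val_inj; have := rE (Ordinal n1); rewrite /= mE !mul1n => /eqP.
by rewrite eqn_modDl !modn_small// => /eqP.
Qed.

(** All [n * w_i] turn out to be natural numbers in arithmetic progression modulo [n]; their
    quotients by [n] give [u], their residues give [m] and [k]. *)
Lemma cycle_point_surj (R : realType) (p T t : nat) (w : 'rV[R]_p.+1) :
  (1 < p)%N -> odd p.+1 -> (t <= T)%N ->
  (forall i, 0 <= w 0 i) -> \sum_i w 0 i = t%:R ->
  (forall j, (w *m map_mx intr (laplacianB (@cycle_graph p.+1))) 0 j
     \is a Num.int) ->
  exists a, @cycle_point R p.+1 T a = w.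
Proof.
move=> p1 n_odd tT w0 wt wint.
have n0 : p.+1%:R != 0 :> R by rewrite pnatr_eq0.
have [|prog nd] := cycle_coord_progression p1 _ wint.
  by split=> [|x y xi yi]; rewrite ?rpred0 ?rpredB.
have {prog}[z zE] : exists z : 'I_p.+1 -> int, forall i,
    w 0 i = w 0 ord0 + (w 0 ord0 - w 0 ord_max) *+ i + (z i)%:~R.
  have /choice[z zE] i := intrP (prog i).
  by exists z => i; rewrite -zE; ring.
move: nd zE; set d := w 0 ord0 - w 0 ord_max => nd zE.
have w_le i : w 0 i <= t%:R.
  by rewrite -wt (bigD1 i)//= lerDl sumr_ge0.
(* Summing all coordinates produces the term [d * n * (n - 1) / 2], an integer because [n * d] is
   one and [n] is odd. *)
have nw0 : w 0 ord0 *+ p.+1 \is a Num.int.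
  have sumE : (\sum_(i < p.+1) i = p.+1 * p./2)%N.
    by rewrite -(big_mkord xpredT id) bin2_sum bin2odd.
  have -> : w 0 ord0 *+ p.+1 =
      t%:R - d *+ p.+1 *+ p./2 - (\sum_i z i)%:~R.
    rewrite -wt (eq_bigr _ (fun i _ => zE i)) 2!big_split/= sumr_const card_ord.
    rewrite sumrMnr sumE mulrnA.
    by rewrite rmorph_sum/=; ring.
  by apply: rpredB (intr_int _ _); rewrite rpredB ?natr_int// rpredMn.
have [M ME] : exists M : nat, w 0 ord0 *+ p.+1 = M%:R.
  by apply/natrP; rewrite natrEint nw0 mulrn_wge0.
(* The difference [d] may be negative; adding [t] makes it nonnegative and leaves [n * d] unchanged
   modulo [n]. *)
have [K KE] : exists K : nat, (d + t%:R) *+ p.+1 = K%:R.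
  apply/natrP; rewrite natrEint; apply/andP; split.
    by rewrite mulrnDl rpredD// rpredMn// natr_int.
  by rewrite mulrn_wge0// /d -addrA addr_ge0// addrC subr_ge0.
have /choice[v vE] i : exists v : nat, w 0 i *+ p.+1 = v%:R.
  apply/natrP; rewrite natrEint mulrn_wge0// andbT zE 2!mulrnDl.
  by rewrite [_ *+ i *+ _]mulrnAC !rpredD// rpredMn// intr_int.
have vmod i : (v i = M + i * K %[mod p.+1])%N.
  apply/eqP; rewrite -eqz_nat -!modz_nat.
  have -> : (v i)%:Z = (z i - t%:Z * i%:Z) * p.+1%:Z + (M + i * K)%:Z.
    apply: (@intr_inj R); rewrite rmorphD rmorphM rmorphB rmorphM/= -!pmulrn.
    by rewrite natrD natrM -[(v i)%:R]vE -ME -KE zE; ring.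
  by rewrite modzMDl.
have v_lt i : (v i %/ p.+1 < T.+1)%N.
  rewrite ltnS; apply: leq_trans tT; rewrite -(mulnK t (ltn0Sn p)) leq_div2r//.
  by rewrite -(ler_nat R) natrM -vE mulr_natr lerMn2r w_le orbT.
exists (inord (M %% p.+1), inord (K %% p.+1), [ffun i => inord (v i %/ p.+1)]).
apply/rowP => i; rewrite mxE/= ffunE !inordK ?ltn_pmod//.
have -> : ((M %% p.+1 + i * (K %% p.+1)) %% p.+1 = v i %% p.+1)%N.
  by rewrite modnDml -modnDmr modnMmr modnDmr vmod.
apply: (mulIf n0); rewrite mulrDl divfK// -natrM -natrD -divn_eq -vE.
by rewrite mulr_natr.
Qed.

Lemma cycle_lattice_count (R : realType) (p T t : nat) :
  (1 < p)%N -> odd p.+1 -> (t <= T)%N ->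
  lattice_count (@laplacian_simplex R p.+1 (@cycle_graph p.+1)) t =
  #|[pred a : 'I_p.+1 * 'I_p.+1 * {ffun 'I_p.+1 -> 'I_T.+1} |
      \sum_i a.2 i + height p.+1 a.1.1 a.1.2 == t]%N|.
Proof.
move=> p1 n_odd tT; rewrite /lattice_count /laplacian_simplex.
set V := map_mx _ _; set D := [pred a | _].
have -> : dilate t (conv_rows V) `&` @int_lattice R p =
    [set` [fset cycle_point R a *m V | a in D]%fset].
  apply/seteqP; split=> x /=.
    move=> [/dilate_conv_rowsP[w [w0 wt ->]] wint].
    have [a aE] := cycle_point_surj p1 n_odd tT w0 wt wint.
    apply/imfsetP; exists a; last by rewrite aE.
    by rewrite inE/= -(eqr_nat R) -sum_cycle_point// aE wt.
  move=> /imfsetP[a /=]; rewrite inE => /eqP aD ->; split.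
    apply/dilate_conv_rowsP; exists (cycle_point R a); split=> //.
      exact: cycle_point_ge0.
    by rewrite sum_cycle_point// aD.
  by move=> j; apply: cycle_point_int.
rewrite set_fsetK card_in_imfset/=; first by rewrite -cardE.
move=> a b /eqP aD /eqP bD /eqP.
(* Both weight vectors sum to [t], so their difference has sum 0 and image 0. *)
rewrite -subr_eq0 -mulmxBl => /eqP/(mul_cycle_laplacianB_inj p1) ab.
apply: (@cycle_point_inj R) => //; first exact: ltnW.
apply/eqP; rewrite -subr_eq0; apply/eqP/ab.
rewrite (eq_bigr (fun i => cycle_point R a 0 i - cycle_point R b 0 i)).
  by rewrite sumrB !sum_cycle_point// aD bD subrr.
by move=> i _; rewrite mxE [X in _ + X]mxE.
Qed.

(** * Ehrhart series and unimodality *)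

Lemma ehrhart_series_cycle_simplex (R : realType) (p T t : nat) :
  (1 < p)%N -> odd p.+1 -> (t <= T)%N ->
  ehrhart_series (@laplacian_simplex R p.+1 (@cycle_graph p.+1)) t =
  (height_poly p.+1 * (\sum_(i < T.+1) 'X^i) ^+ p.+1)`_t.
Proof.
move=> p1 n_odd tT; rewrite coef_height_poly_geometric -(cycle_lattice_count R)//.
(* The constant term is 1 by convention; it agrees with the count at [t = 0], where the dilate is
   the origin alone. *)
rewrite /ehrhart_series; case: eqP => // ->; rewrite /lattice_count.
rewrite (_ : _ `&` _ = [set` [fset 0 : 'rV[R]_p]%fset]); last first.
  apply/seteqP; split=> x /=.
    by move=> [[y _ <-] _]; rewrite scale0r in_fset1.
  rewrite in_fset1 => /eqP ->; split; last by move=> j; rewrite mxE.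
  eexists; [exact: (conv_rows_row _ ord0)|by rewrite scale0r].
by rewrite set_fsetK cardfs1.
Qed.

Theorem theorem5p7 (R : realType) (n : nat) (n_odd : odd n) (n_ge3 : (3 <= n)%N) :
  exists h : seq int,
    hstar_vector (@laplacian_simplex R n (@cycle_graph n)) h /\ unimodal h.
Proof.
case: n n_odd n_ge3 => // p n_odd; rewrite ltnS => p1.
(* Heights are below [n], so cutting the coefficients to the prescribed length [d + 1 = n] loses
   nothing. *)
have hE k : (mkseq (nth 0 (height_poly p.+1)) p.+1)`_k = (height_poly p.+1)`_k.
  have [kn|nk] := ltnP k p.+1; first by rewrite nth_mkseq.
  by rewrite nth_default ?size_mkseq// coef_height_poly_ge.
exists (mkseq (nth 0 (height_poly p.+1)) p.+1); split.
  exists p; split; [exact: cycle_simplex_dim|by rewrite size_mkseq|].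
  move=> k; rewrite hE -(@coef_exp_geometric p.+1 k _ k)// coefM.
  apply: eq_bigr => i _; congr (_ * _).
  by apply: ehrhart_series_cycle_simplex => //; exact: leq_subr.
(* The peak is the common centre [(n - 1) / 2]. *)
exists p.+1./2; rewrite size_mkseq; split=> [|i ij|i ij _].
- by lia.
- by rewrite !hE coef_height_poly_incr.
- by rewrite !hE coef_height_poly_decr.
Qed.
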